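(* Let $P,Q\in\mathbb{SC}_n$ be deformed $n$-permutahedra with $Q\prec P$. Then $$\mathbb{DC}(Q\boxdot P)=\mathcal{C}(P,Q)\qquad\text{and}\qquad \mathbb{DC}\bigl(\uparrow\!(Q\boxdot P)\bigr)=\mathcal{C}(P,Q)\oplus\mathbb{R}e_{n+1}.$$
   Context: A polytope $Q\subset\mathbb{R}^d$ is a deformation of a polytope $P\subset\mathbb{R}^d$, written $Q\trianglelefteq P$, if there exist $\lambda>0$ and a polytope $R$ with $Q+R=\lambda P$ (Minkowski sum). The deformation cone is $\mathbb{DC}(P)=\{Q\subset\mathbb{R}^d : Q\trianglelefteq P\}$, a cone under Minkowski sum and dilation. A deformed $n$-permutahedron is a polytope in $\mathbb{R}^n$ all of whose edges are parallel to vectors $e_i-e_j$, $i,j\in[n]$ (equivalently, a deformation of the permutahedron $\Pi_n=\mathrm{conv}\{(\sigma(1),\dots,\sigma(n)):\sigma\in\mathcal{S}_n\}$). $\mathbb{SC}_n=\mathbb{DC}(\Pi_n)$ is the cone of all deformed $n$-permutahedra. For $\sigma\in\mathcal{S}_n$ let $C_\sigma=\{c\in\mathbb{R}^n : c_{\sigma(1)}\le\dots\le c_{\sigma(n)}\}$; for $P\in\mathbb{SC}_n$, $P^\sigma$ is the vertex of $P$ maximizing $\langle\cdot,c\rangle$ for any $c$ in the interior of $C_\sigma$, and $P^\sigma_i$ its $i$-th coordinate. For $P,Q\in\mathbb{SC}_n$: $Q\preceq P$ (''form a quotient'') means $Q^\sigma_i\le P^\sigma_i$ for all $\sigma\in\mathcal{S}_n$,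 $i\in[n]$; $Q\prec P$ (''generic quotient'') means $Q^\sigma_i<P^\sigma_i$ for all $\sigma\in\mathcal{S}_n$, $i\in[n]$. The GP-sum is $Q\boxdot P=(Q+\mathbb{R}^n_+)\cap(P+\mathbb{R}^n_-)$. The admissibility cone of $P,Q$ with $Q\prec P$ is $\mathcal{C}(P,Q)=\{Q'\boxdot P' : P'\trianglelefteq P,\ Q'\trianglelefteq Q,\ Q'\preceq P'\}$. The lift of a polytope $S\subset\mathbb{R}^n$ is $\uparrow\! S=\{(x,-\sum_i x_i):x\in S\}\subset\mathbb{R}^{n+1}$. In the second identity, $\mathcal{C}(P,Q)$ is identified with its image under the lift; that is, the right-hand side denotes $\{\uparrow\! S+c\,e_{n+1} : S\in\mathcal{C}(P,Q),\ c\in\mathbb{R}\}$. *)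

(* Defs.v *)
From mathcomp Require Import all_boot all_order all_algebra all_fingroup.
From mathcomp Require Import all_classical all_reals all_analysis.

Set Implicit Arguments.
Unset Strict Implicit.
Unset Printing Implicit Defensive.

Import Order.TTheory GRing.Theory Num.Theory.
Import numFieldNormedType.Exports.
Local Open Scope classical_set_scope.
Local Open Scope ring_scope.

Section Polytopes.
Variables (R : realType) (d : nat).
Implicit Types (P Q A B : set 'rV[R]_d) (x y : 'rV[R]_d).

Definition dot x y : R := \sum_i x 0 i * y 0 i.

Definition msum A B : set 'rV[R]_d := [set x + y | x in A & y in B].
Definition dilate (l : R) A : set 'rV[R]_d := [set l *: x | x in A].

Definition conv A : set 'rV[R]_d := smallest (@convex_set R 'rV[R]_d) A.

(* Polytopes are nonempty; an empty Q or R could not satisfy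
   Q + R = l P with P nonempty. *)
Definition polytope P : Prop :=
  exists A : set 'rV[R]_d, [/\ finite_set A, A !=set0 & P = conv A].

Definition deformation Q P : Prop :=
  [/\ polytope Q, polytope P &
      exists (l : R) (S : set 'rV[R]_d),
        [/\ 0 < l, polytope S & msum Q S = dilate l P]].

Definition DC P : set (set 'rV[R]_d) := [set Q | deformation Q P].

End Polytopes.

Section Permutahedra.
Variables (R : realType) (n : nat).
Implicit Types (P Q : set 'rV[R]_n) (s : 'S_n).

(* Indices are 0-based, hence the successor. *)
Definition permutahedron : set 'rV[R]_n :=
  conv (range (fun s : 'S_n => \row_i ((s i).+1%:R : R))).

Definition SC : set (set 'rV[R]_n) := DC permutahedron.

Definition chamber s : set 'rV[R]_n :=
  [set c | forall i j : 'I_n, (i <= j)%N -> c 0 (s i) <= c 0 (s j)].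

(* The maximizer is unique, the interior of the chamber being a nonempty open
   set; it exists when P is in SC. The default value 0 is then irrelevant. *)
Definition chamber_vertex P s : 'rV[R]_n :=
  xget 0 [set v | P v /\
    forall c, (chamber s)° c -> forall x, P x -> dot x c <= dot v c].

Definition quotient Q P : Prop :=
  forall s (i : 'I_n), chamber_vertex Q s 0 i <= chamber_vertex P s 0 i.

Definition generic_quotient Q P : Prop :=
  forall s (i : 'I_n), chamber_vertex Q s 0 i < chamber_vertex P s 0 i.

Definition nonneg_orthant : set 'rV[R]_n := [set x | forall i, 0 <= x 0 i].
Definition nonpos_orthant : set 'rV[R]_n := [set x | forall i, x 0 i <= 0].

Definition gpsum Q P : set 'rV[R]_n :=
  msum Q nonneg_orthant `&` msum P nonpos_orthant.

Definition admissibility_cone P Q : set (set 'rV[R]_n) :=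
  [set S | exists P' Q', [/\ deformation P' P, deformation Q' Q,
                             quotient Q' P' & S = gpsum Q' P']].

Definition lift_point (x : 'rV[R]_n) : 'rV[R]_(n + 1) :=
  row_mx x (const_mx (- \sum_i x 0 i)).

Definition lift_set (S : set 'rV[R]_n) : set 'rV[R]_(n + 1) := lift_point @` S.

Definition e_last : 'rV[R]_(n + 1) := delta_mx 0 (rshift n ord0).

(* The sum of F and R e_(n+1), F being identified with its image under the
   lift. *)
Definition lifted_cone (F : set (set 'rV[R]_n)) : set (set 'rV[R]_(n + 1)) :=
  [set T | exists S (c : R), F S /\ T = [set x + c *: e_last | x in lift_set S]].

End Permutahedra.

Arguments permutahedron R n : clear implicits.
Arguments SC R n : clear implicits.
Arguments e_last R n : clear implicits.

(* Main.v *)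
Require Import Defs.
From mathcomp Require Import all_boot all_order all_algebra all_fingroup.
From mathcomp Require Import all_classical all_reals all_analysis.
From mathcomp Require Import ring lra.
(* Imported again so that conv and quotient do not denote the operation of
   convex spaces and the quotient of groups. *)
Import Defs.

Import Order.TTheory GRing.Theory Num.Theory.
Import numFieldNormedType.Exports.

Local Open Scope classical_set_scope.
Local Open Scope ring_scope.

Set Implicit Arguments.
Unset Strict Implicit.
Unset Printing Implicit Defensive.

(** The proof works with maximizing vertices instead of normal fans. On a
    chamber C_s a deformed permutahedron P is maximized by the single point
    P^s, so its support function is linear there. Cut C_s into the cones
    D_(s,k), k = 0, ..., n, in which the k smallest coordinates are nonpositive
    and the others nonnegative. Writing c as its positive part plus its
    negative part, both of which stay in C_s, bounds the support function of
    gpsum Q P at c in D_(s,k) by its value at the point W_(s,k) with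
    coordinates Q^s_i at the first k places of the order s and P^s_i at the
    others; and W_(s,k) lies in gpsum Q P because Q^s <= W_(s,k) <= P^s
    whenever Q is a quotient of P (gpsum_face). These cones cover the space, so
    a separation argument gives gpsum Q P = conv {W_(s,k)} (gpsum_conv). As
    W_(s,k) is additive in (P, Q), so is gpsum on quotients (gpsum_msum).

    Admissible implies deformation: let P1 + P2 = l1 P and Q1 + Q2 = l2 Q with
    Q1 a quotient of P1. Then P1 and Q1 have complements in m P and m Q for
    every large m, with vertices m P^s - P1^s and m Q^s - Q1^s. Since
    Q^s_i < P^s_i, for m large these complements again form a quotient
    (quotient_complement), and gpsum_msum exhibits gpsum Q1 P1 as a summand of
    m (gpsum Q P).

    Deformation implies admissible: let X + Y = l (gpsum Q P) and decompose
    l W_(s,k) = x_(s,k) + y_(s,k); then x_(s,k) maximizes X on D_(s,k). On the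
    common wall of D_(s,k) and D_(s,k+1), which spans a hyperplane c_(s k) = 0,
    both x_(s,k) and x_(s,k+1) are maximal, so they differ only in the
    coordinate s k, and there the first is the larger. Hence x_(s,k) is mixed
    from x_(s,n) and x_(s,0) exactly as W_(s,k) is mixed from Q^s and P^s
    (split_maximizers). The points x_(s,0) and x_(s,n) are the vertices of the
    faces of X on which the sum of the coordinates is maximal, respectively
    minimal. The same faces of gpsum Q P are P and Q, so the faces of X are
    deformations of P and Q, they form a quotient, and X is their gpsum.

    For the lift, the hyperplane in which the coordinates sum to 0 is the image
    of the linear injection x |-> (x, - sum x). A summand of a polytope in this
    hyperplane lies in a parallel hyperplane, so up to a multiple of e_(n+1) it
    is itself a lift (DC_lift). *)

(** * The scalar product *)

Section Dot.
Variables (R : realType) (d : nat).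
Implicit Types x y c : 'rV[R]_d.

Lemma dotC x y : dot x y = dot y x.
Proof. by apply: eq_bigr => i _; rewrite mulrC. Qed.

Lemma dotDl x y c : dot (x + y) c = dot x c + dot y c.
Proof.
by rewrite /dot -big_split/=; apply: eq_bigr => i _; rewrite mxE mulrDl.
Qed.

Lemma dotZl l x c : dot (l *: x) c = l * dot x c.
Proof.
by rewrite /dot mulr_sumr; apply: eq_bigr => i _; rewrite mxE mulrA.
Qed.

Lemma dotNl x c : dot (- x) c = - dot x c.
Proof. by rewrite -scaleN1r dotZl mulN1r. Qed.

Lemma dotBl x y c : dot (x - y) c = dot x c - dot y c.
Proof. by rewrite dotDl dotNl. Qed.

Lemma dotDr c x y : dot c (x + y) = dot c x + dot c y.
Proof. by rewrite dotC dotDl !(dotC c). Qed.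

Lemma dotZr l c x : dot c (l *: x) = l * dot c x.
Proof. by rewrite dotC dotZl (dotC c). Qed.

Lemma dotNr c x : dot c (- x) = - dot c x.
Proof. by rewrite dotC dotNl (dotC c). Qed.

Lemma dot_deltar x i : dot x (delta_mx 0 i) = x 0 i.
Proof.
rewrite /dot (bigD1 i)//= mxE !eqxx mulr1 big1 ?addr0// => j ji.
by rewrite mxE (negbTE ji) andbF mulr0.
Qed.

Lemma dot_sq_ge0 x : 0 <= dot x x.
Proof. by apply: sumr_ge0 => i _; rewrite -expr2 sqr_ge0. Qed.

Lemma dot_sq_eq0 x : dot x x = 0 -> x = 0.
Proof.
move=> x0; apply/rowP => i; rewrite mxE; apply/eqP; rewrite -sqrf_eq0.
apply/eqP.
have/psumr_eq0P: forall j : 'I_d, true -> 0 <= x 0 j * x 0 j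
  by move=> j _; rewrite -expr2 sqr_ge0.
by move=> /(_ x0 i isT); rewrite expr2.
Qed.

End Dot.

(** * Convex sets and separation from a finite hull *)

Section Convexity.
Variables (R : realType) (d : nat).
Implicit Types (A B K : set 'rV[R]_d) (x y c : 'rV[R]_d).

Lemma convexP K : convex_set K <->
  forall x y t, 0 <= t -> t <= 1 -> K x -> K y -> K (t *: x + (1 - t) *: y).
Proof.
split=> [cK x y t t0 t1 Kx Ky|cK x y t].
  by have := cK x y (Itv01 t0 t1); rewrite !inE => /(_ Kx Ky).
rewrite !inE => Kx Ky; apply: cK => //.
Qed.

Lemma convex_conv A : convex_set (conv A).
Proof.
apply/convexP => x y t t0 t1 Ax Ay K [cK AK].
by move/convexP: (cK); apply => //; [apply: Ax|apply: Ay].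
Qed.

Lemma conv_sub A K : convex_set K -> A `<=` K -> conv A `<=` K.
Proof. by move=> cK AK x; apply. Qed.

Lemma sub_conv A : A `<=` conv A.
Proof. exact: sub_smallest. Qed.

Lemma convex_msum A B : convex_set A -> convex_set B -> convex_set (msum A B).
Proof.
move=> /convexP cA /convexP cB; apply/convexP.
move=> _ _ t t0 t1 [x Ax [y By <-]] [x' Ax' [y' By' <-]].
exists (t *: x + (1 - t) *: x'); first exact: cA.
exists (t *: y + (1 - t) *: y'); first exact: cB.
by rewrite !scalerDr addrACA.
Qed.

Lemma convex_dilate l A : convex_set A -> convex_set (dilate l A).
Proof.
move=> /convexP cA; apply/convexP => _ _ t t0 t1 [x Ax <-] [y Ay <-].
exists (t *: x + (1 - t) *: y); first exact: cA.
by rewrite scalerDr !scalerA (mulrC l) (mulrC l).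
Qed.

Lemma convex_setI A B : convex_set A -> convex_set B -> convex_set (A `&` B).
Proof.
move=> /convexP cA /convexP cB; apply/convexP => x y t t0 t1 [Ax Bx] [Ay By].
by split; [apply: cA|apply: cB].
Qed.

Lemma convex_comb_in K (I : finType) (w : I -> R) (a : I -> 'rV[R]_d) :
  convex_set K -> (forall i, K (a i)) -> (forall i, 0 <= w i) ->
  \sum_i w i = 1 -> K (\sum_i w i *: a i).
Proof.
move=> /convexP cK Ka w0 w1.
(* Partial sums are normalized, which makes an induction on the list possible. *)
suff H (s : seq I) : 0 < \sum_(i <- s) w i ->
    K ((\sum_(i <- s) w i)^-1 *: \sum_(i <- s) w i *: a i).
  by have := H (index_enum I); rewrite w1 invr1 scale1r; apply.
elim: s => [|i s IH]; first by rewrite big_nil ltxx.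
rewrite !big_cons; set W := \sum_(j <- s) w j => W0.
have Wge0 : 0 <= W by apply: sumr_ge0.
move: (Wge0); rewrite le_eqVlt => /predU1P[Weq|Wgt].
  have -> : \sum_(j <- s) w j *: a j = 0.
    rewrite big_seq big1// => j js.
    have : w j <= W by rewrite /W (big_rem j)//= lerDl sumr_ge0.
    by rewrite -Weq => wj; rewrite (@le_anti _ _ (w j) 0) ?scale0r// wj w0.
  rewrite -Weq !addr0 in W0 *.
  by rewrite scalerA mulVf ?scale1r// gt_eqF.
have -> : (w i + W)^-1 *: (w i *: a i + \sum_(j <- s) w j *: a j) =
   (w i / (w i + W)) *: a i + (1 - w i / (w i + W)) *: (W^-1 *: \sum_(j <- s) w j *: a j).
  rewrite scalerDr !scalerA (mulrC (_^-1)); congr (_ + _ *: _).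
  by field; rewrite !gt_eqF.
apply: cK => //; last exact: IH.
- by rewrite divr_ge0// ltW.
- by rewrite ler_pdivrMr// mul1r lerDl.
Qed.

(** If x were outside, let y be the point of the hull of the a i - x of least
    norm. Every a i - x then has a positive scalar product with y, otherwise
    moving a little from y towards it would shorten y; so c = - y has no i as
    assumed. The minimum is taken over the weights, which form a compact set. *)
Lemma conv_range_separation (m : nat) (a : 'I_m -> 'rV[R]_d) x :
  (forall c, exists i, dot x c <= dot (a i) c) -> conv (range a) x.
Proof.
move=> H.
have [i0 _] := H 0.
pose D := [set w : 'rV[R]_m | forall i, [set` `[0, 1]] (w 0 i)] `&`
          [set w : 'rV[R]_m | \sum_i w 0 i = 1].
pose y (w : 'rV[R]_m) := \sum_i w 0 i *: (a i - x).
have ysum (w : 'rV[R]_m) : \sum_i w 0 i = 1 -> y w = \sum_i w 0 i *: a i - x.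
  move=> w1; rewrite /y -[in RHS](scale1r x) -w1 scaler_suml -sumrB.
  by apply: eq_bigr => i _; rewrite scalerBr.
have sumcont p (F : 'I_p -> 'rV[R]_m -> R) : (forall i, continuous (F i)) ->
    continuous (fun w => \sum_i F i w).
  by move=> cF; apply: continuous_big => //; exact: add_continuous.
have ycont : continuous (fun w => dot (y w) (y w)).
  suff yc i : continuous (fun w => y w 0 i).
    by apply: sumcont => i w; apply: continuousM; exact: yc.
  have -> : (fun w => y w 0 i) = (fun w => \sum_j w 0 j * (a j - x) 0 i).
    by apply/funext => w; rewrite /y summxE; apply: eq_bigr => j _; rewrite mxE.
  apply: sumcont => j w.
  by apply: continuousM; [exact: coord_continuous|exact: cst_continuous].
have Dcompact : compact D.
  apply: compact_closedI.
    exact: (@rV_compact R m (fun=> [set` `[0, 1]]) (fun=> @segment_compact R 0 1)).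
  apply: (@closed_comp _ _ (fun w : 'rV[R]_m => \sum_i w 0 i) [set 1]).
    by move=> w _; apply: sumcont => i; exact: coord_continuous.
  exact: closed_eq.
have sum_delta (i : 'I_m) : \sum_j (delta_mx 0 i : 'rV[R]_m) 0 j = 1.
  rewrite (bigD1 i)//= mxE !eqxx big1 ?addr0// => j ji.
  by rewrite mxE (negbTE ji).
have Dmix (w : 'rV[R]_m) i t : D w -> 0 <= t -> t <= 1 ->
    D ((1 - t) *: w + t *: delta_mx 0 i).
  move=> [w01 w1] t0 t1; split=> [j|] /=.
    move: (w01 j); rewrite /= !mxE eqxx !in_itv/= => /andP[? ?].
    by case: (_ == _) => /=; rewrite ?mulr0 ?mulr1; apply/andP; split; nra.
  under eq_bigr do rewrite mxE [X in X + _]mxE [X in _ + X]mxE.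
  by rewrite big_split/= -!mulr_sumr w1 sum_delta !mulr1 subrK.
have D0 : D !=set0.
  exists (delta_mx 0 i0); split=> [j|] /=; last exact: sum_delta.
  by rewrite /= mxE eqxx in_itv/=; case: (_ == _); rewrite /= ?lexx ?ler01.
have [w /set_mem Dw wmin] := EVT_min_rV D0 Dcompact (continuous_subspaceT ycont).
have [w01 w1] := Dw.
suff y0 : y w = 0.
  have -> : x = \sum_i w 0 i *: a i by apply/esym/eqP; rewrite -subr_eq0 -ysum// y0.
  apply: convex_comb_in => //; first exact: convex_conv.
  - by move=> i; apply: sub_conv; exists i.
  - by move=> i; have := w01 i; rewrite /= in_itv/= => /andP[].
have [i] := H (- y w); rewrite !dotNr lerN2 => yi.
set b := a i - x.
have yb : dot b (y w) <= 0 by rewrite dotBl subr_le0.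
apply: dot_sq_eq0; apply/eqP; rewrite eq_le dot_sq_ge0 andbT leNgt; apply/negP.
set N := dot (y w) (y w) => N0.
have B0 := dot_sq_ge0 b; set B := dot b b in B0.
(* Moving from y w by t towards b changes the squared norm by at most
   t (t B - (2 - t) N), which this t makes negative. *)
pose t := N / (N + B + 1).
have t0 : 0 < t by rewrite divr_gt0//; lra.
have t1 : t <= 1 by rewrite ler_pdivrMr; lra.
have tB : t * (N + B + 1) = N by rewrite /t divfK// gt_eqF//; lra.
clearbody t.
have := wmin _ (mem_set (Dmix _ i _ Dw (ltW t0) t1)).
have -> : y ((1 - t) *: w + t *: delta_mx 0 i) = (1 - t) *: y w + t *: b.
  rewrite /y.
  under eq_bigr do
    rewrite mxE [X in X + _]mxE [X in _ + X]mxE scalerDl -!scalerA.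
  rewrite big_split/= -!scaler_sumr; congr (_ + _ *: _).
  rewrite (bigD1 i)//= mxE !eqxx scale1r big1 ?addr0// => j ji.
  by rewrite mxE (negbTE ji) scale0r.
clearbody b. rewrite !(dotDl, dotDr, dotZl, dotZr) -/N -/B (dotC (y w) b).
set u := dot b (y w) in yb *.
move=> hmin.
have tu : t * (1 - t) * u <= 0.
  by rewrite mulr_ge0_le0 ?mulr_ge0 ?subr_ge0 ?(ltW t0).
have h1 : N <= (1 - t) ^+ 2 * N + t ^+ 2 * B by nra.
have h2 : t * (N * (2 - t)) <= t * (t * B) by nra.
move: h2; rewrite ler_pM2l// => h2.
nra.
Qed.

End Convexity.

(** * Faces of polytopes and of Minkowski sums *)

Section Polytopes.
Variables (R : realType) (d : nat).
Implicit Types (A B K X Y Z : set 'rV[R]_d) (x y c u v : 'rV[R]_d).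

Lemma conv_finrange_separation (I : finType) (a : I -> 'rV[R]_d) x :
  (forall c, exists i, dot x c <= dot (a i) c) -> conv (range a) x.
Proof.
move=> H.
have := @conv_range_separation R d #|I| (a \o enum_val) x.
have sub : range (a \o enum_val : 'I_#|I| -> _) `<=` conv (range a).
  by move=> _ [i _ <-]; apply: sub_conv; exists (enum_val i).
move=> /(_ _)/(conv_sub (@convex_conv _ _ _) sub); apply.
by move=> c; have [i ?] := H c; exists (enum_rank i); rewrite /= enum_rankK.
Qed.

(** Faces take the place of support functions: face u A x says that u attains
    its maximum over A at x. *)
Definition face u A : set 'rV[R]_d :=
  [set x | A x /\ forall y, A y -> dot y u <= dot x u].

(** A point of K outside the hull of the w i would be separated from it by a
    direction, but some w i maximizes this direction over K. *)
Lemma conv_maximizers (I : finType) K (w : I -> 'rV[R]_d) :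
  convex_set K -> (forall i, K (w i)) -> (forall c, exists i, face c K (w i)) ->
  K = conv (range w).
Proof.
move=> cK Kw H; apply/seteqP; split=> [x Kx|]; last first.
  by apply: conv_sub => // _ [i _ <-].
apply: conv_finrange_separation => c; have [i [_ wi]] := H c.
by exists i; apply: wi.
Qed.

Lemma polytope_conv_range (I : finType) (i0 : I) (w : I -> 'rV[R]_d) :
  polytope (conv (range w)).
Proof.
exists (range w); split=> //; last by exists (w i0), i0.
exact: finite_image.
Qed.

Lemma polytope_convex A : polytope A -> convex_set A.
Proof. by move=> [B [_ _ ->]]; exact: convex_conv. Qed.

Lemma polytope_nonempty A : polytope A -> A !=set0.
Proof. by move=> [B [_ [b Bb] ->]]; exists b; exact: sub_conv. Qed.

Lemma msumC A B : msum A B = msum B A.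
Proof.
apply/seteqP; split=> _ [x Ax [y By <-]];
  by exists y => //; exists x => //; rewrite addrC.
Qed.

Lemma msumA A B K : msum A (msum B K) = msum (msum A B) K.
Proof.
apply/seteqP; split.
  move=> _ [x Ax [_ [y By [z Kz <-]] <-]].
  by exists (x + y); [exists x => //; exists y|exists z => //; rewrite addrA].
move=> _ [_ [x Ax [y By <-]] [z Kz <-]].
by exists x => //; exists (y + z); [exists y => //; exists z|rewrite addrA].
Qed.

(** The inclusion from left to right is where convexity enters: l x + m y is
    l + m times the average of x and y with weights l and m. *)
Lemma msum_dilate l m A : convex_set A -> 0 < l -> 0 <= m ->
  msum (dilate l A) (dilate m A) = dilate (l + m) A.
Proof.
move=> /convexP cA l0 m0; apply/seteqP; split; last first.
  move=> _ [x Ax <-]; rewrite scalerDl.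
  by exists (l *: x); [exists x|exists (m *: x) => //; exists x].
move=> _ [_ [x Ax <-] [_ [y Ay <-] <-]].
have lm : 0 < l + m by lra.
exists ((l / (l + m)) *: x + (1 - l / (l + m)) *: y).
  by apply: cA => //; [rewrite divr_ge0// ltW|rewrite ler_pdivrMr//; lra].
rewrite scalerDr !scalerA mulrBr mulrCA divff ?gt_eqF// !mulr1.
by rewrite addrAC subrr add0r.
Qed.

Lemma face_msum A B u a b : A a -> B b ->
  face u (msum A B) (a + b) -> face u A a.
Proof.
move=> Aa Bb [_ H]; split=> // x Ax.
have : msum A B (x + b) by exists x => //; exists b.
by move=> /H; rewrite !dotDl lerD2r.
Qed.

(** A sum a + b maximizes u over A + B only if a and b do so separately,
    because either could be replaced by a better point. *)
Lemma face_msumE A B u : face u (msum A B) = msum (face u A) (face u B).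
Proof.
apply/seteqP; split=> [x|].
  move=> fx; have [[a Aa [b Bb ab]] _] := fx; subst x.
  exists a; first exact: face_msum fx.
  exists b => //; move: fx; rewrite msumC addrC; exact: face_msum.
move=> _ [a [Aa Ha] [b [Bb Hb] <-]]; split; first by exists a => //; exists b.
by move=> _ [x Ax [y By <-]]; rewrite !dotDl lerD ?Ha ?Hb.
Qed.

Lemma face_dilate l u Z : 0 < l -> face u (dilate l Z) = dilate l (face u Z).
Proof.
move=> l0; apply/seteqP; split.
  move=> _ [[z Zz <-] H]; exists z => //; split=> // y Zy.
  have : dilate l Z (l *: y) by exists y.
  by move=> /H; rewrite !dotZl ler_pM2l.
move=> _ [z [Zz H] <-]; split; first by exists z.
by move=> _ [y Zy <-]; rewrite !dotZl ler_pM2l// H.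
Qed.

(** The face of conv B is the hull of the points of B in it: those points y of
    conv B that lie in this hull as soon as they lie in the face form a convex
    set, since a point strictly between two others can maximize u only if both
    of them do. *)
Lemma polytope_face A u : polytope A -> face u A !=set0 -> polytope (face u A).
Proof.
move=> [B [finB B0 ->]] [x0 fx0]; have [Bx0 x0max] := fx0.
pose C := B `&` face u (conv B).
have cface : convex_set (face u (conv B)).
  apply/convexP => x y t t0 t1 [Bx xm] [By ym].
  split; first by move/convexP: (@convex_conv R d B); apply.
  move=> z Bz; rewrite dotDl !dotZl; have := xm _ Bz; have := ym _ Bz; nra.
have faceE : face u (conv B) = conv C.
  apply/seteqP; split; last by apply: conv_sub => // x [].
  (* The set of the points known to satisfy the claim contains B and is convex. *)
  pose G := conv B `&` [set y | face u (conv B) y -> conv C y].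
  have cG : convex_set G.
    apply/convexP => x y t t0 t1 [Bx Gx] [By Gy].
    have Bxy : conv B (t *: x + (1 - t) *: y).
      by move/convexP: (@convex_conv R d B); apply.
    split=> // -[_ fxy].
    move: t0 t1; rewrite le_eqVlt => /predU1P[t0 _|t0].
      move: fxy; rewrite -t0 scale0r add0r subr0 scale1r => fxy; exact: Gy.
    rewrite le_eqVlt => /predU1P[t1|t1].
      move: fxy; rewrite t1 scale1r subrr scale0r addr0 => fxy; exact: Gx.
    have hx := fxy _ Bx; have hy := fxy _ By.
    rewrite dotDl !dotZl in hx hy.
    have xy : dot x u = dot y u by nra.
    have fz z : conv B z -> dot z u <= dot y u.
      by move=> /fxy; rewrite dotDl !dotZl; nra.
    move/convexP: (@convex_conv R d C); apply; [lra|lra| |].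
      by apply: Gx; split=> // z /fz; rewrite xy.
    by apply: Gy; split.
  have BG : B `<=` G.
    move=> b Bb; split; first exact: sub_conv.
    by move=> fb; apply: sub_conv.
  by move=> x fx; have [_] := conv_sub cG BG fx.1; apply.
exists C; split=> //; first exact: finite_setIl.
apply/set0P/negP => /eqP C0; move: fx0; rewrite faceE C0.
by move=> /(_ set0); apply; split=> // ? ? ?; rewrite in_set0.
Qed.

(** Taking the face in direction u commutes with sums and dilations, so it turns
    X + Y = l Z into the same relation between the faces. *)
Lemma deformation_face X Z u : deformation X Z -> face u Z !=set0 ->
  deformation (face u X) (face u Z).
Proof.
move=> [pX pZ [l [Y [l0 pY XY]]]] Z0.
have FE : msum (face u X) (face u Y) = dilate l (face u Z).
  by rewrite -face_msumE XY face_dilate.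
have [z fz] := Z0.
have [x fx [y fy _]] : msum (face u X) (face u Y) (l *: z).
  by rewrite FE; exists z.
split; [by apply: polytope_face => //; exists x|exact: polytope_face|].
by exists l, (face u Y); split=> //; apply: polytope_face => //; exists y.
Qed.

End Polytopes.

(** * Chambers and vertices of deformed permutahedra *)

Section Chambers.
Variables (R : realType) (n : nat).
Implicit Types (A B P Q Z : set 'rV[R]_n) (c u v x : 'rV[R]_n) (s : 'S_n).

(** Write j as the number of m with m < j. Both sides become sums over m of the
    sum of f over n - m - 1 indices, and the last indices are the best choice.
    After subtracting f m from every f j this holds term by term; the
    subtraction is harmless because both choices have the same size. *)
Lemma rearrangement (f : 'I_n -> R) (r : 'S_n) :
  (forall i j : 'I_n, (i <= j)%N -> f i <= f j) ->
  \sum_(j < n) (r j)%:R * f j <= \sum_(j < n) j%:R * f j.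
Proof.
move=> f_mono.
have natE (j : 'I_n) : j%:R = \sum_(m < n) (m < j)%:R :> R.
  rewrite -natr_sum; congr (_%:R).
  rewrite (eq_bigr (fun m : 'I_n => if (m < j)%N then 1%N else 0%N)); last first.
    by move=> m _; case: (m < j)%N.
  rewrite -big_mkcond/= -(big_ord_widen _ (fun=> 1%N) (ltnW (ltn_ord j))).
  by rewrite sum1_card card_ord.
rewrite -subr_ge0 -sumrB.
under eq_bigr do rewrite -mulrBl natE (natE (r _)) -sumrB mulr_suml.
rewrite exchange_big; apply: sumr_ge0 => m _.
have balance : \sum_(j < n) ((m < j)%:R - (m < r j)%:R) = 0 :> R.
  rewrite sumrB (reindex_inj (@perm_inj _ r))/= subrr//.
have -> : \sum_(j < n) ((m < j)%:R - (m < r j)%:R) * f j =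
          \sum_(j < n) ((m < j)%:R - (m < r j)%:R) * (f j - f m).
  under [RHS]eq_bigr do rewrite mulrBr.
  by rewrite sumrB -mulr_suml balance mul0r subr0.
apply: sumr_ge0 => j _.
have [mj|jm] := ltnP m j.
  apply: mulr_ge0; last by rewrite subr_ge0 f_mono// ltnW.
  by rewrite subr_ge0 lern1 leq_b1.
apply: mulr_le0; last by rewrite subr_le0 f_mono.
by rewrite sub0r oppr_le0 ler0n.
Qed.

Lemma chamber_cover c : exists s, chamber s c.
Proof.
pose leT := fun i j : 'I_n => c 0 i <= c 0 j.
pose t := sort leT (enum 'I_n).
have sz : size t = n by rewrite size_sort size_enum_ord.
have ut : uniq t by rewrite sort_uniq enum_uniq.
pose f (i : 'I_n) := nth i t i.
have f_inj : injective f.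
  move=> i j; rewrite /f (set_nth_default i) ?sz// => /eqP.
  by rewrite nth_uniq ?sz// => /eqP/val_inj.
exists (perm f_inj) => i j ij.
rewrite !permE /f [X in _ <= c 0 X](set_nth_default i) ?sz//.
have tr : transitive leT by move=> ? ? ?; exact: le_trans.
have st : sorted leT t by apply: sort_sorted => ? ?; exact: le_total.
apply: (sorted_leq_nth tr _ i st) => //; rewrite ?inE ?sz//.
by move=> ?; exact: lexx.
Qed.

Lemma chamber_interior s c :
  (forall i j : 'I_n, (i < j)%N -> c 0 (s i) + 1 <= c 0 (s j)) ->
  (chamber s)° c.
Proof.
move=> H; apply/nbhs_ballP; exists (1 / 2) => /=; first by lra.
move=> c' [_ cc'] i j; rewrite leq_eqVlt => /predU1P[/val_inj->//|/H].
have := cc' 0 (s i); have := cc' 0 (s j).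
rewrite /ball/= !ltr_norml => /andP[? ?] /andP[? ?] ?; lra.
Qed.

(** A point of the interior of the chamber of s whose coordinate at s k is 0,
    with gaps 2, so that adding 1 to any coordinate does not leave the
    interior. The two scalar products of a point with ramp s k and with
    ramp s k + e_(s j) determine its coordinate at s j, which is how equality
    of coordinates is read off from maximality. *)
Definition ramp s k : 'rV[R]_n := \row_i (2 * ((s^-1%g i)%:R - k%:R)).

Lemma rampE s k i : ramp s k 0 (s i) = 2 * (i%:R - k%:R).
Proof. by rewrite mxE permK. Qed.

Lemma bumpE s k i j :
  (ramp s k + delta_mx 0 (s j)) 0 (s i) = 2 * (i%:R - k%:R) + (i == j)%:R.
Proof. by rewrite mxE rampE mxE eqxx (inj_eq perm_inj). Qed.

Lemma ramp_interior s k : (chamber s)° (ramp s k).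
Proof.
apply: chamber_interior => i j ij; rewrite !rampE.
have : i.+1%:R <= j%:R :> R by rewrite ler_nat.
rewrite -natr1; lra.
Qed.

Lemma bump_interior s k j : (chamber s)° (ramp s k + delta_mx 0 (s j)).
Proof.
apply: chamber_interior => i i' ii'; rewrite !bumpE.
have : i.+1%:R <= i'%:R :> R by rewrite ler_nat.
rewrite -natr1; case: (i == j); case: (i' == j) => /=; lra.
Qed.

Lemma dot_bump s k j x :
  dot x (ramp s k + delta_mx 0 (s j)) = dot x (ramp s k) + x 0 (s j).
Proof. by rewrite dotDr dot_deltar. Qed.

(** Two maximizers for all interior directions have the same scalar product with
    an open set of directions, hence coincide. *)
Lemma chamber_vertex_unique P s v :
  (forall c, chamber s c -> face c P v) -> chamber_vertex P s = v.
Proof.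
move=> H; rewrite /chamber_vertex; apply: xget_unique.
  have [Pv _] := H _ (interior_subset (ramp_interior s 0)).
  split=> // c cs x Px.
  by have [_] := H _ (interior_subset cs); apply.
move=> w [Pw wmax].
have dotE c : (chamber s)° c -> dot w c = dot v c.
  move=> cs; apply: le_anti; rewrite wmax ?andbT.
  - by have [_] := H _ (interior_subset cs); apply.
  - exact: cs.
  - by have [] := H _ (interior_subset cs).
apply/rowP => i; rewrite -[i](permKV s).
have := dotE _ (bump_interior s 0 (s^-1%g i)).
by rewrite !dot_bump (dotE _ (ramp_interior s 0)) => /addrI.
Qed.

(** Linearity of the support function on each closed chamber: in contrast to the
    direction of the edges, it passes to convex summands and dilations by a
    computation with single points. *)
Definition gen_perm P :=
  convex_set P /\ forall s c, chamber s c -> face c P (chamber_vertex P s).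

Lemma gen_permI P : convex_set P ->
  (forall s, exists v, forall c, chamber s c -> face c P v) -> gen_perm P.
Proof.
move=> cP H; split=> // s c cs; have [v Hv] := H s.
by rewrite (chamber_vertex_unique Hv); exact: Hv.
Qed.

(** If a + b = l Z^s then a maximizes over A every direction that Z^s maximizes
    over Z, whatever the decomposition. *)
Lemma gen_perm_summand l A B Z : convex_set A -> gen_perm Z -> 0 < l ->
  msum A B = dilate l Z -> gen_perm A.
Proof.
move=> cA [_ HZ] l0 ABZ; apply: gen_permI => // s.
have s0 : chamber s (0 : 'rV[R]_n) by move=> i j ?; rewrite !mxE.
have fz c : chamber s c -> face c (msum A B) (l *: chamber_vertex Z s).
  move=> cs; rewrite ABZ face_dilate//.
  by exists (chamber_vertex Z s) => //; apply: HZ.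
have [[a Aa [b Bb ab]] _] := fz _ s0.
exists a => c cs; apply: (face_msum Aa Bb); rewrite ab; exact: fz.
Qed.

Lemma chamber_vertex_msum A B s : gen_perm A -> gen_perm B ->
  chamber_vertex (msum A B) s = chamber_vertex A s + chamber_vertex B s.
Proof.
move=> [_ HA] [_ HB]; apply: chamber_vertex_unique => c cs.
by rewrite face_msumE; exists (chamber_vertex A s); [exact: HA|
  exists (chamber_vertex B s) => //; exact: HB].
Qed.

Lemma gen_perm_msum A B : gen_perm A -> gen_perm B -> gen_perm (msum A B).
Proof.
move=> [cA HA] [cB HB]; split; first exact: convex_msum.
move=> s c cs; rewrite chamber_vertex_msum// face_msumE.
by exists (chamber_vertex A s); [exact: HA|exists (chamber_vertex B s) => //; exact: HB].
Qed.

Lemma chamber_vertex_dilate l A s : 0 < l -> gen_perm A ->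
  chamber_vertex (dilate l A) s = l *: chamber_vertex A s.
Proof.
move=> l0 [_ HA]; apply: chamber_vertex_unique => c cs.
by rewrite face_dilate//; exists (chamber_vertex A s) => //; exact: HA.
Qed.

Lemma gen_perm_dilate l A : 0 < l -> gen_perm A -> gen_perm (dilate l A).
Proof.
move=> l0 [cA HA]; split; first exact: convex_dilate.
move=> s c cs; rewrite chamber_vertex_dilate// face_dilate//.
by exists (chamber_vertex A s) => //; exact: HA.
Qed.

(** Over the permutahedron, a direction of the chamber of s is maximized by
    placing the values 1, ..., n in the order s. *)
Lemma gen_perm_permutahedron : gen_perm (permutahedron R n).
Proof.
apply: gen_permI => [|s]; first exact: convex_conv.
pose p (t : 'S_n) : 'rV[R]_n := \row_i ((t i).+1%:R : R).
exists (p s^-1%g) => c cs; split; first by apply: sub_conv; exists s^-1%g.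
move=> x; move: x; apply: (@conv_sub R n _ [set x | dot x c <= dot (p s^-1%g) c]).
  apply/convexP => x y t t0 t1 /= hx hy; rewrite dotDl !dotZl; nra.
move=> _ [t _ <-] /=.
rewrite -/(p t) /dot (reindex_inj (@perm_inj _ s)) [leRHS](reindex_inj (@perm_inj _ s))/=.
under eq_bigr do rewrite mxE -natr1 mulrDl mul1r.
under [leRHS]eq_bigr do rewrite mxE permK -natr1 mulrDl mul1r.
rewrite !big_split/= lerD2r.
have := @rearrangement (fun j => c 0 (s j)) (s * t)%g cs.
by rewrite (eq_bigr (fun j : 'I_n => (t (s j))%:R * c 0 (s j)))// => j _; rewrite permM.
Qed.

Lemma deformation_gen_perm A P : gen_perm P -> deformation A P -> gen_perm A.
Proof.
move=> gP [/polytope_convex cA _ [l [S [l0 _ ASP]]]].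
exact: gen_perm_summand gP l0 ASP.
Qed.

Lemma SC_gen_perm P : SC R n P -> gen_perm P.
Proof. exact/deformation_gen_perm/gen_perm_permutahedron. Qed.

Lemma gen_perm_conv P : gen_perm P -> P = conv (range (chamber_vertex P)).
Proof.
move=> [cP HP]; apply: conv_maximizers => //.
  by move=> s; have [] := HP s _ (interior_subset (ramp_interior s 0)).
by move=> c; have [s cs] := chamber_cover c; exists s; apply: HP.
Qed.

End Chambers.

(** * Vertices and extreme faces of a GP-sum *)

Section GPSum.
Variables (R : realType) (n : nat).
Implicit Types (A B K P Q X Y Z : set 'rV[R]_n) (c u v x : 'rV[R]_n) (s : 'S_n).

(** Weak inequalities on both sides make the parts for k and k + 1 share a wall,
    along which maximizers can be compared. *)
Definition split_chamber s (k : nat) : set 'rV[R]_n :=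
  [set c | chamber s c /\
    forall j : 'I_n, if (j < k)%N then c 0 (s j) <= 0 else 0 <= c 0 (s j)].

Lemma split_chamber_cover c : exists s (k : 'I_n.+1), split_chamber s k c.
Proof.
have [s cs] := chamber_cover c; exists s.
pose p k := [forall j : 'I_n, (k <= j)%N ==> (0 <= c 0 (s j))].
have pn : exists k, p k.
  by exists n; apply/forallP => j; rewrite leqNgt ltn_ord.
(* This k is the least one from which on all coordinates, in the order s, are
   nonnegative; by minimality the coordinate just before it is negative. *)
case: (ex_minnP pn) => k /forallP/(_ _)/implyP pk kmin.
have kn : (k < n.+1)%N.
  by rewrite ltnS; apply: kmin; apply/forallP => j; rewrite leqNgt ltn_ord.
exists (Ordinal kn); split=> // j /=; case: ltnP => jk; last exact: pk.
have k0 : (0 < k)%N by case: (k) jk.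
have : ~~ p k.-1.
  by apply/negP => /kmin; rewrite leqNgt prednK ?leqnn.
rewrite negb_forall => /existsP[i]; rewrite negb_imply -ltNge => /andP[ki ci].
apply: le_trans (ltW ci); apply: cs.
by apply: leq_trans ki; rewrite -ltnS prednK.
Qed.

Lemma split_chamber0 s k : split_chamber s k 0.
Proof. by split=> [i j _|j]; rewrite !mxE//; case: ifP. Qed.

Lemma split_chamber_conv K (w : 'S_n -> nat -> 'rV[R]_n) : convex_set K ->
  (forall s k c, split_chamber s k c -> face c K (w s k)) ->
  K = conv (range (fun sk : 'S_n * 'I_n.+1 => w sk.1 sk.2)).
Proof.
move=> cK H; apply: conv_maximizers => //.
  by move=> [s k]; have [] := H s k _ (split_chamber0 s k).
by move=> c; have [s [k ck]] := split_chamber_cover c; exists (s, k); exact: H.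
Qed.

(** The vertex of gpsum Q P that maximizes the directions of split_chamber s k. *)
Definition mixed_vertex P Q s (k : nat) : 'rV[R]_n :=
  \row_i if (s^-1%g i < k)%N then chamber_vertex Q s 0 i
         else chamber_vertex P s 0 i.

Lemma mixed_vertex0 P Q s : mixed_vertex P Q s 0 = chamber_vertex P s.
Proof. by apply/rowP => i; rewrite mxE. Qed.

Lemma mixed_vertexn P Q s : mixed_vertex P Q s n = chamber_vertex Q s.
Proof. by apply/rowP => i; rewrite mxE ltn_ord. Qed.

Lemma convex_nonneg : convex_set (@nonneg_orthant R n).
Proof.
apply/convexP => x y t t0 t1 x0 y0 i.
have := x0 i; have := y0 i; rewrite !mxE; nra.
Qed.

Lemma convex_nonpos : convex_set (@nonpos_orthant R n).
Proof.
apply/convexP => x y t t0 t1 x0 y0 i.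
have := x0 i; have := y0 i; rewrite !mxE; nra.
Qed.

Lemma convex_gpsum Q P : convex_set Q -> convex_set P -> convex_set (gpsum Q P).
Proof.
move=> cQ cP; apply: convex_setI; apply: convex_msum => //.
  exact: convex_nonneg.
exact: convex_nonpos.
Qed.

Lemma dot_nonneg x c : (forall i, 0 <= x 0 i * c 0 i) -> 0 <= dot x c.
Proof. by move=> H; apply: sumr_ge0 => i _. Qed.

Lemma gen_perm_vertex P s : gen_perm P -> P (chamber_vertex P s).
Proof. by move=> [_ HP]; have [] := HP s _ (interior_subset (ramp_interior R s 0)). Qed.

(** In a direction c = cm + cp with cm <= 0 <= cp, a point q + b = p + a of the
    GP-sum satisfies dot x cm <= dot q cm and dot x cp <= dot p cp. As cm and cp
    stay in the chamber of s, these are bounded by the values at Q^s and P^s,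
    which the mixed vertex attains. *)
Lemma gpsum_face P Q s k c : gen_perm P -> gen_perm Q -> quotient Q P ->
  split_chamber s k c -> face c (gpsum Q P) (mixed_vertex P Q s k).
Proof.
move=> gP gQ QP [cs ck]; split.
  split.
    exists (chamber_vertex Q s); first exact: gen_perm_vertex.
    exists (mixed_vertex P Q s k - chamber_vertex Q s); last by rewrite addrC subrK.
    by move=> i; rewrite !mxE subr_ge0; case: ifP => // _; exact: QP.
  exists (chamber_vertex P s); first exact: gen_perm_vertex.
  exists (mixed_vertex P Q s k - chamber_vertex P s); last by rewrite addrC subrK.
  by move=> i; rewrite !mxE subr_le0; case: ifP => // _; exact: QP.
pose cm : 'rV[R]_n := \row_i if (s^-1%g i < k)%N then c 0 i else 0.
pose cp : 'rV[R]_n := \row_i if (s^-1%g i < k)%N then 0 else c 0 i.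
have cE : c = cm + cp.
  by apply/rowP => i; rewrite !mxE; case: ifP; rewrite ?addr0 ?add0r.
have sgn i : if (s^-1%g i < k)%N then c 0 i <= 0 else 0 <= c 0 i.
  by have := ck (s^-1%g i); rewrite permKV.
have cms : chamber s cm.
  move=> i j ij; rewrite !mxE !permK; have := cs i j ij.
  have := ck i; have := ck j; have [jk|kj] := ltnP j k.
    by rewrite (leq_ltn_trans ij jk).
  by case: ifP.
have cps : chamber s cp.
  move=> i j ij; rewrite !mxE !permK; have := cs i j ij.
  have := ck i; have := ck j; have [jk|kj] := ltnP j k.
    by rewrite (leq_ltn_trans ij jk).
  by case: ifP.
have mm : dot (mixed_vertex P Q s k) cm = dot (chamber_vertex Q s) cm.
  by apply: eq_bigr => i _; rewrite !mxE; case: ifP => // _; rewrite !mulr0.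
have mp : dot (mixed_vertex P Q s k) cp = dot (chamber_vertex P s) cp.
  by apply: eq_bigr => i _; rewrite !mxE; case: ifP => // _; rewrite !mulr0.
move=> x [[q Qq [b b0 xq]] [p Pp [a a0 xp]]].
rewrite cE !dotDr mm mp lerD//.
  have [_ /(_ _ Qq)] := gQ.2 _ _ cms; apply: le_trans.
  rewrite -xq dotDl gerDl -oppr_ge0 -dotNl; apply: dot_nonneg => i.
  rewrite !mxE; have := sgn i; have := b0 i; case: ifP => _; nra.
have [_ /(_ _ Pp)] := gP.2 _ _ cps; apply: le_trans.
rewrite -xp dotDl gerDl -oppr_ge0 -dotNl; apply: dot_nonneg => i.
rewrite !mxE; have := sgn i; have := a0 i; case: ifP => _; nra.
Qed.

Lemma mixed_vertex_in P Q s k : gen_perm P -> gen_perm Q -> quotient Q P ->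
  gpsum Q P (mixed_vertex P Q s k).
Proof. by move=> gP gQ QP; have [] := gpsum_face gP gQ QP (split_chamber0 s k). Qed.

Lemma gpsum_conv P Q : gen_perm P -> gen_perm Q -> quotient Q P ->
  gpsum Q P =
  conv (range (fun sk : 'S_n * 'I_n.+1 => mixed_vertex P Q sk.1 sk.2)).
Proof.
move=> gP gQ QP; apply: split_chamber_conv => [|s k c].
  by apply: convex_gpsum; [case: gQ|case: gP].
exact: gpsum_face.
Qed.

Lemma polytope_gpsum P Q : gen_perm P -> gen_perm Q -> quotient Q P ->
  polytope (gpsum Q P).
Proof.
by move=> gP gQ QP; rewrite gpsum_conv//; apply: polytope_conv_range (1%g, ord0) _.
Qed.

(** One inclusion is immediate. For the other, the mixed vertices of the sums,
    whose hull is the right-hand side, are sums of mixed vertices. *)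
Lemma gpsum_msum P1 P2 Q1 Q2 : gen_perm P1 -> gen_perm P2 ->
  gen_perm Q1 -> gen_perm Q2 -> quotient Q1 P1 -> quotient Q2 P2 ->
  msum (gpsum Q1 P1) (gpsum Q2 P2) = gpsum (msum Q1 Q2) (msum P1 P2).
Proof.
move=> gP1 gP2 gQ1 gQ2 QP1 QP2; apply/seteqP; split.
  move=> _ [x [[q1 q1Q [b1 b1p x1]] [p1 p1P [a1 a1n x1']]]
           [y [[q2 q2Q [b2 b2p y1]] [p2 p2P [a2 a2n y1']]] <-]].
  split.
    exists (q1 + q2); first by exists q1 => //; exists q2.
    exists (b1 + b2); last by rewrite addrACA x1 y1.
    by move=> i; rewrite mxE addr_ge0.
  exists (p1 + p2); first by exists p1 => //; exists p2.
  exists (a1 + a2); last by rewrite addrACA x1' y1'.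
  by move=> i; rewrite mxE -oppr_ge0 opprD addr_ge0 ?oppr_ge0.
rewrite gpsum_conv; [|exact: gen_perm_msum|exact: gen_perm_msum|]; last first.
  by move=> s i; rewrite !chamber_vertex_msum// !mxE lerD ?QP1 ?QP2.
apply: conv_sub.
  case: gP1 gP2 gQ1 gQ2 => [? _] [? _] [? _] [? _].
  by apply: convex_msum; exact: convex_gpsum.
move=> _ [[s k] _ <-] /=.
exists (mixed_vertex P1 Q1 s k); first exact: mixed_vertex_in.
exists (mixed_vertex P2 Q2 s k); first exact: mixed_vertex_in.
by apply/rowP => i; rewrite !mxE !chamber_vertex_msum// !mxE; case: ifP.
Qed.

Lemma gpsum_dilate l P Q : 0 < l ->
  dilate l (gpsum Q P) = gpsum (dilate l Q) (dilate l P).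
Proof.
move=> l0; have ln0 : l != 0 by rewrite gt_eqF.
apply/seteqP; split.
  move=> _ [x [[q Qq [b bp x1]] [p Pp [a an x2]]] <-]; split.
    exists (l *: q); first by exists q.
    exists (l *: b); last by rewrite -scalerDr x1.
    by move=> i; rewrite mxE mulr_ge0 ?(ltW l0).
  exists (l *: p); first by exists p.
  exists (l *: a); last by rewrite -scalerDr x2.
  by move=> i; rewrite mxE mulr_ge0_le0 ?(ltW l0).
move=> x [[_ [q Qq <-] [b bp x1]] [_ [p Pp <-] [a an x2]]].
exists (l^-1 *: x); last by rewrite scalerA divff// scale1r.
split.
  exists q => //; exists (l^-1 *: b).
    by move=> i; rewrite mxE mulr_ge0 ?invr_ge0 ?(ltW l0).
  by rewrite -x1 scalerDr scalerA mulVf// scale1r.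
exists p => //; exists (l^-1 *: a).
  by move=> i; rewrite mxE mulr_ge0_le0 ?invr_ge0 ?(ltW l0).
by rewrite -x2 scalerDr scalerA mulVf// scale1r.
Qed.

Local Notation ones := (const_mx 1 : 'rV[R]_n).

Lemma dot_ones x : dot x ones = \sum_i x 0 i.
Proof. by apply: eq_bigr => i _; rewrite mxE mulr1. Qed.

(** Both the constant vector 1 and its opposite lie in every chamber, so each
    P^s maximizes and minimizes the sum of the coordinates over P. *)
Lemma gen_perm_level P x y : gen_perm P -> P x -> P y -> dot x ones = dot y ones.
Proof.
move=> [_ HP].
have [_ m1] : face ones P (chamber_vertex P 1%g).
  by apply: HP => i j _; rewrite !mxE.
have [_ m2] : face (- ones) P (chamber_vertex P 1%g).
  by apply: HP => i j _; rewrite !mxE.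
have level z : P z -> dot z ones = dot (chamber_vertex P 1%g) ones.
  by move=> Pz; apply: le_anti; rewrite m1//=; have := m2 _ Pz; rewrite !dotNr lerN2.
by move=> Px Py; rewrite !level.
Qed.

Lemma sub_gpsuml P Q : gen_perm P -> gen_perm Q -> quotient Q P -> Q `<=` gpsum Q P.
Proof.
move=> gP gQ QP; rewrite {1}(gen_perm_conv gQ); apply: conv_sub.
  by apply: convex_gpsum; [exact: gQ.1|exact: gP.1].
move=> _ [s _ <-]; rewrite -(mixed_vertexn P); exact: mixed_vertex_in.
Qed.

Lemma sub_gpsumr P Q : gen_perm P -> gen_perm Q -> quotient Q P -> P `<=` gpsum Q P.
Proof.
move=> gP gQ QP; rewrite {1}(gen_perm_conv gP); apply: conv_sub.
  by apply: convex_gpsum; [exact: gQ.1|exact: gP.1].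
move=> _ [s _ <-]; rewrite -(mixed_vertex0 _ Q); exact: mixed_vertex_in.
Qed.

Lemma nonneg_sum0 x : nonneg_orthant x -> dot x ones <= 0 -> x = 0.
Proof.
rewrite dot_ones => x0 s0; apply/rowP => i; rewrite mxE.
have/psumr_eq0P : forall j : 'I_n, true -> 0 <= x 0 j by [].
by apply => //; apply: le_anti; rewrite s0 sumr_ge0.
Qed.

(** A point p + a with a <= 0 has the maximal sum of coordinates, that of p, only
    if a = 0. *)
Lemma gpsum_face_top P Q : gen_perm P -> gen_perm Q -> quotient Q P ->
  face ones (gpsum Q P) = P.
Proof.
move=> gP gQ QP; apply/seteqP; split.
  move=> _ [[_ [p Pp [a an <-]]] H].
  have := H _ (sub_gpsumr gP gQ QP Pp).
  rewrite dotDl lerDl => da.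
  have : - a = 0 by apply: nonneg_sum0 => [i|]; rewrite ?mxE ?dotNl ?oppr_ge0 ?oppr_le0.
  by move/eqP; rewrite oppr_eq0 => /eqP ->; rewrite addr0.
move=> p Pp; split; first exact: sub_gpsumr.
move=> _ [_ [p' Pp' [a an <-]]]; rewrite (gen_perm_level gP Pp Pp') dotDl gerDl.
by rewrite -oppr_ge0 -dotNl; apply: dot_nonneg => i; rewrite !mxE mulr1 oppr_ge0.
Qed.

Lemma gpsum_face_bottom P Q : gen_perm P -> gen_perm Q -> quotient Q P ->
  face (- ones) (gpsum Q P) = Q.
Proof.
move=> gP gQ QP; apply/seteqP; split.
  move=> _ [[[q Qq [b bp <-]] _] H].
  have := H _ (sub_gpsuml gP gQ QP Qq).
  rewrite !dotNr dotDl lerN2 gerDl => db.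
  by rewrite (nonneg_sum0 bp db) addr0.
move=> q Qq; split; first exact: sub_gpsuml.
move=> _ [[q' Qq' [b bp <-]] _].
rewrite !dotNr (gen_perm_level gQ Qq Qq') dotDl lerN2 lerDl.
by apply: dot_nonneg => i; rewrite !mxE mulr1.
Qed.

End GPSum.

(** * The two inclusions between the cones *)

Section DeformationCone.
Variables (R : realType) (n : nat).
Implicit Types (A B K P Q X Y Z : set 'rV[R]_n) (c u v x : 'rV[R]_n) (s : 'S_n).

Local Notation ones := (const_mx 1 : 'rV[R]_n).

(** Any decomposition of a vertex of the sum yields the vertex of the summand. *)
Lemma chamber_vertex_summand l A B Z s a b : gen_perm Z -> 0 < l ->
  msum A B = dilate l Z -> A a -> B b -> a + b = l *: chamber_vertex Z s ->
  chamber_vertex A s = a.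
Proof.
move=> [_ HZ] l0 AB Aa Bb ab; apply: chamber_vertex_unique => c cs.
apply: (face_msum Aa Bb); rewrite ab AB face_dilate//.
by exists (chamber_vertex Z s) => //; exact: HZ.
Qed.

(** The vertices of P3 and Q3 at s are m P^s - P1^s and m Q^s - Q1^s, so that m
    must dominate the ratio of P1^s_i - Q1^s_i to P^s_i - Q^s_i for all s and i;
    this is the place where Q must be a generic quotient of P. *)
Lemma quotient_complement l1 l2 P P1 P2 Q Q1 Q2 :
  gen_perm P -> gen_perm P1 -> gen_perm P2 ->
  gen_perm Q -> gen_perm Q1 -> gen_perm Q2 ->
  0 < l1 -> 0 < l2 -> msum P1 P2 = dilate l1 P -> msum Q1 Q2 = dilate l2 Q ->
  generic_quotient Q P ->
  exists m P3 Q3, [/\ 0 < m, gen_perm P3, gen_perm Q3,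
    quotient Q3 P3 & msum P1 P3 = dilate m P /\ msum Q1 Q3 = dilate m Q].
Proof.
move=> gP gP1 gP2 gQ gQ1 gQ2 l10 l20 PE QE QP.
pose gap (A B : set 'rV[R]_n) s i := chamber_vertex A s 0 i - chamber_vertex B s 0 i.
have gapPQ s i : 0 < gap P Q s i by rewrite subr_gt0 QP.
pose M : R := \sum_(si : 'S_n * 'I_n) `|gap P1 Q1 si.1 si.2 / gap P Q si.1 si.2|.
have M0 : 0 <= M by apply: sumr_ge0.
have Mgap s i : gap P1 Q1 s i <= M * gap P Q s i.
  rewrite -ler_pdivrMr//; apply: le_trans (ler_norm _) _.
  by rewrite /M (bigD1 (s, i))//= lerDl sumr_ge0.
pose m := l1 + l2 + M.
have complement l A B C : gen_perm A -> gen_perm B -> gen_perm C -> 0 < l ->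
    msum B C = dilate l A -> l < m ->
    [/\ gen_perm (msum C (dilate (m - l) A)),
        msum B (msum C (dilate (m - l) A)) = dilate m A &
        forall s, chamber_vertex (msum C (dilate (m - l) A)) s =
          m *: chamber_vertex A s - chamber_vertex B s].
  move=> gA gB gC l0 BC lm.
  have ml0 : 0 < m - l by rewrite subr_gt0.
  have gD := gen_perm_dilate ml0 gA.
  have gE := gen_perm_msum gC gD.
  have E : msum B (msum C (dilate (m - l) A)) = dilate m A.
    rewrite msumA BC msum_dilate ?(ltW ml0)//; last exact: gA.1.
    by rewrite addrC subrK.
  split=> // s.
  have m0 : 0 < m := lt_trans l0 lm.
  rewrite -(chamber_vertex_dilate s m0 gA) -E (chamber_vertex_msum s gB gE).
  by rewrite [RHS]addrC addKr.
have l1m : l1 < m by rewrite /m; lra.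
have l2m : l2 < m by rewrite /m; lra.
have [gP3 EP vP] := complement l1 _ _ _ gP gP1 gP2 l10 PE l1m.
have [gQ3 EQ vQ] := complement l2 _ _ _ gQ gQ1 gQ2 l20 QE l2m.
exists m, (msum P2 (dilate (m - l1) P)), (msum Q2 (dilate (m - l2) Q)).
split=> //; first exact: lt_trans l1m.
move=> s i; rewrite vP vQ !mxE; have := Mgap s i; have := gapPQ s i.
rewrite /m /gap; nra.
Qed.

Lemma admissible_deformation P Q : gen_perm P -> gen_perm Q ->
  generic_quotient Q P -> admissibility_cone P Q `<=` DC (gpsum Q P).
Proof.
move=> gP gQ QP _ [P1 [Q1 [dP dQ QP1 ->]]].
have gP1 := deformation_gen_perm gP dP.
have gQ1 := deformation_gen_perm gQ dQ.
have [_ pP [l1 [P2 [l10 pP2 PE]]]] := dP.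
have [_ pQ [l2 [Q2 [l20 pQ2 QE]]]] := dQ.
have gP2 : gen_perm P2.
  by apply: (gen_perm_summand (B := P1) (polytope_convex pP2) gP l10); rewrite msumC PE.
have gQ2 : gen_perm Q2.
  by apply: (gen_perm_summand (B := Q1) (polytope_convex pQ2) gQ l20); rewrite msumC QE.
have [m [P3 [Q3 [m0 gP3 gQ3 QP3 [EP EQ]]]]] :=
  quotient_complement gP gP1 gP2 gQ gQ1 gQ2 l10 l20 PE QE QP.
have wQP : quotient Q P by move=> s i; apply/ltW/QP.
split; [exact: polytope_gpsum|exact: polytope_gpsum|].
exists m, (gpsum Q3 P3); split=> //; first exact: polytope_gpsum.
by rewrite gpsum_msum// EP EQ gpsum_dilate.
Qed.

Lemma ramp_split s k : split_chamber s k (ramp R s k).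
Proof.
split=> [|j]; first exact: interior_subset (ramp_interior R s k).
rewrite rampE; case: ltnP; rewrite -(ler_nat R) -?natr1; lra.
Qed.

Lemma ramp_splitS s k : split_chamber s k.+1 (ramp R s k).
Proof.
split=> [|j]; first exact: interior_subset (ramp_interior R s k).
rewrite rampE; case: ltnP; rewrite -(ler_nat R) -!natr1; lra.
Qed.

Lemma bump_split s k j : split_chamber s k (ramp R s k + delta_mx 0 (s j)).
Proof.
split=> [|i]; first exact: interior_subset (bump_interior R s k j).
rewrite bumpE; case: (i == j); case: ltnP; rewrite -(ler_nat R) -?natr1 /=; lra.
Qed.

Lemma bump_splitS s (k : nat) (j : 'I_n) : k != j ->
  split_chamber s k.+1 (ramp R s k + delta_mx 0 (s j)).
Proof.
move=> kj; split=> [|i]; first exact: interior_subset (bump_interior R s k j).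
rewrite bumpE; case: eqP => [->|_]; case: ltnP; rewrite ?ltnS;
  rewrite ?[(j <= k)%N]leq_eqVlt ?[_ == k]eq_sym ?(negbTE kj) /=;
  by rewrite -(ler_nat R) -?natr1 /=; lra.
Qed.

(** The wall between split_chamber s k and split_chamber s k.+1 contains ramp s k
    and ramp s k + e_(s j) for all j other than k. Both x s k and x s k.+1 are
    maximal on it, so they agree in all coordinates but s k. In the direction
    ramp s k + e_(s k), which lies in split_chamber s k only, x s k is at least
    as good, so its coordinate at s k is at least as large. *)
Lemma split_maximizers X (x : 'S_n -> nat -> 'rV[R]_n) :
  (forall s k c, split_chamber s k c -> face c X (x s k)) ->
  (forall s (j : 'I_n), x s n 0 (s j) <= x s 0 0 (s j)) /\
  (forall s k (j : 'I_n), (k <= n)%N ->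
     x s k 0 (s j) = if (j < k)%N then x s n 0 (s j) else x s 0 0 (s j)).
Proof.
move=> H.
have dotE s k k' c : split_chamber s k c -> split_chamber s k' c ->
    dot (x s k) c = dot (x s k') c.
  move=> /H[Xk mk] /H[Xk' mk']; apply: le_anti; rewrite mk'// mk//.
have step s (k : nat) (j : 'I_n) : k != j -> x s k 0 (s j) = x s k.+1 0 (s j).
  move=> kj; have := dotE _ _ _ _ (bump_split s k j) (bump_splitS s kj).
  by rewrite !dot_bump (dotE _ _ _ _ (ramp_split s k) (ramp_splitS s k)) => /addrI.
have drop s (j : 'I_n) : x s j.+1 0 (s j) <= x s j 0 (s j).
  have [_ mj] := H _ _ _ (bump_split s j j).
  have [Xj _] := H _ _ _ (ramp_splitS s j).
  have := mj _ Xj.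
  by rewrite !dot_bump (dotE _ _ _ _ (ramp_split s j) (ramp_splitS s j)) lerD2l.
have const s k k' (j : 'I_n) : (k <= k')%N ->
    (forall i, (k <= i < k')%N -> i != j) -> x s k 0 (s j) = x s k' 0 (s j).
  elim: k' => [|k' IH]; first by rewrite leqn0 => /eqP ->.
  rewrite leq_eqVlt => /predU1P[->//|]; rewrite ltnS => kk' Hi.
  rewrite IH//; last by move=> i /andP[ki ik']; apply: Hi; rewrite ki ltnW.
  by apply: step; apply: Hi; rewrite kk' leqnn.
have low s k (j : 'I_n) : (k <= j)%N -> x s k 0 (s j) = x s 0 0 (s j).
  by move=> kj; apply/esym/const => // i /andP[_ ik]; rewrite ltn_eqF// (leq_trans ik).
have high s k (j : 'I_n) : (j < k <= n)%N -> x s k 0 (s j) = x s n 0 (s j).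
  move=> /andP[jk kn]; apply: const => // i /andP[ki _].
  by rewrite gtn_eqF// (leq_trans jk).
split=> [s j|s k j kn].
  by rewrite -(high s j.+1 j) ?ltnS ?leqnn ?ltn_ord// -(low s j j).
by case: ltnP => jk; [apply: high; rewrite jk|apply: low].
Qed.

(** The faces of X with maximal and minimal sum of coordinates play the roles of
    P and Q. *)
Lemma deformation_admissible P Q : gen_perm P -> gen_perm Q ->
  quotient Q P -> DC (gpsum Q P) `<=` admissibility_cone P Q.
Proof.
move=> gP gQ QP X dX; have [pX _ [l [Y [l0 pY XY]]]] := dX.
have decomp s k : exists xy : 'rV[R]_n * 'rV[R]_n,
    [/\ X xy.1, Y xy.2 & xy.1 + xy.2 = l *: mixed_vertex P Q s k].
  have : dilate l (gpsum Q P) (l *: mixed_vertex P Q s k).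
    by exists (mixed_vertex P Q s k) => //; exact: mixed_vertex_in.
  by rewrite -XY => -[x Xx [y Yy xy]]; exists (x, y).
pose x s k := (projT1 (cid (decomp s k))).1.
pose y s k := (projT1 (cid (decomp s k))).2.
have Xx s k : X (x s k) by rewrite /x; case: cid => xy [].
have Yy s k : Y (y s k) by rewrite /y; case: cid => xy [].
have xy s k : x s k + y s k = l *: mixed_vertex P Q s k.
  by rewrite /x /y; case: cid => ? [].
have fx s k c : split_chamber s k c -> face c X (x s k).
  move=> cs; apply: (face_msum (Xx s k) (Yy s k)); rewrite xy XY face_dilate//.
  by exists (mixed_vertex P Q s k) => //; exact: gpsum_face.
have [xn0 xk] := split_maximizers fx.
have facing u A s k : face u (gpsum Q P) = A -> A (mixed_vertex P Q s k) ->
    gen_perm A -> chamber_vertex A s = mixed_vertex P Q s k ->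
    deformation (face u X) A /\ chamber_vertex (face u X) s = x s k.
  move=> fA Am gA vA; split.
    rewrite -fA; apply: deformation_face => //.
    by rewrite fA; exists (mixed_vertex P Q s k).
  have FE : msum (face u X) (face u Y) = dilate l A.
    by rewrite -face_msumE XY face_dilate// fA.
  have fxy : face u (msum X Y) (x s k + y s k).
    by rewrite face_msumE FE xy; exists (mixed_vertex P Q s k).
  apply: (chamber_vertex_summand gA l0 FE (b := y s k)).
  - exact: face_msum (Yy s k) fxy.
  - by apply: face_msum (Yy s k) (Xx s k) _; rewrite msumC addrC.
  - by rewrite xy vA.
have topX s : _ := facing ones P s 0 (gpsum_face_top gP gQ QP).
have botX s : _ := facing (- ones) Q s n (gpsum_face_bottom gP gQ QP).
have {}topX s : deformation (face ones X) P /\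
    chamber_vertex (face ones X) s = x s 0.
  by apply: topX; rewrite ?mixed_vertex0//; exact: gen_perm_vertex.
have {}botX s : deformation (face (- ones) X) Q /\
    chamber_vertex (face (- ones) X) s = x s n.
  by apply: botX; rewrite ?mixed_vertexn//; exact: gen_perm_vertex.
have [dP _] := topX 1%g; have [dQ _] := botX 1%g.
have gP' := deformation_gen_perm gP dP.
have gQ' := deformation_gen_perm gQ dQ.
have QP' : quotient (face (- ones) X) (face ones X).
  move=> s i; rewrite (topX s).2 (botX s).2 -[i](permKV s); exact: xn0.
exists (face ones X), (face (- ones) X); split=> //.
rewrite gpsum_conv// [LHS](split_chamber_conv (polytope_convex pX) fx).
suff -> : (fun sk : 'S_n * 'I_n.+1 => x sk.1 sk.2) =
    (fun sk => mixed_vertex (face ones X) (face (- ones) X) sk.1 sk.2) by [].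
apply/funext => -[s k] /=.
apply/rowP => i; rewrite mxE (topX s).2 (botX s).2 -{1 3 4}[i](permKV s) xk ?permKV//.
by rewrite -ltnS ltn_ord.
Qed.

End DeformationCone.

(** * Affine images and the lift *)

Section AffineImages.
Variable R : realType.

Definition affine_map n m (f : 'rV[R]_n -> 'rV[R]_m) :=
  forall x y t, f (t *: x + (1 - t) *: y) = t *: f x + (1 - t) *: f y.

Lemma image_conv n m (f : 'rV[R]_n -> 'rV[R]_m) (A : set 'rV[R]_n) :
  affine_map f -> f @` conv A = conv (f @` A).
Proof.
move=> fA; apply/seteqP; split.
  move=> _ [x Ax <-]; move: x Ax.
  apply: (@conv_sub R n _ (f @^-1` conv (f @` A))).
    apply/convexP => x y t t0 t1 /= Ax Ay; rewrite fA.
    by move/convexP : (@convex_conv R m (f @` A)); apply.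
  by move=> x Ax; apply: sub_conv; exists x.
apply: conv_sub; last by move=> _ [x Ax <-]; exists x => //; exact: sub_conv.
apply/convexP => _ _ t t0 t1 [x Ax <-] [y Ay <-].
exists (t *: x + (1 - t) *: y); last exact: fA.
by move/convexP : (@convex_conv R n A); apply.
Qed.

Lemma polytope_image n m (f : 'rV[R]_n -> 'rV[R]_m) (A : set 'rV[R]_n) :
  affine_map f -> polytope A -> polytope (f @` A).
Proof.
move=> fA [B [finB [b Bb] ->]]; exists (f @` B); split.
- exact: finite_image.
- by exists (f b), b.
- exact: image_conv.
Qed.

End AffineImages.

Section Lift.
Variables (R : realType) (n : nat).
Implicit Types (S Z : set 'rV[R]_n) (T : set 'rV[R]_(n + 1)) (x : 'rV[R]_n).
Implicit Types (t : 'rV[R]_(n + 1)).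

Local Notation e := (e_last R n).

Lemma lift_pointD x y : lift_point (x + y) = lift_point x + lift_point y.
Proof.
rewrite /lift_point add_row_mx; congr row_mx; apply/rowP => i; rewrite !mxE.
by under eq_bigr do rewrite mxE; rewrite big_split opprD.
Qed.

Lemma lift_pointZ (a : R) x : lift_point (a *: x) = a *: lift_point x.
Proof.
rewrite /lift_point scale_row_mx; congr row_mx; apply/rowP => i; rewrite !mxE.
by under eq_bigr do rewrite mxE; rewrite -mulr_sumr mulrN.
Qed.

Lemma lift_pointK x : lsubmx (lift_point x) = x.
Proof. exact: row_mxKl. Qed.

(** The lift and the last basis vector span the whole space, the coordinate
    along the latter being the sum of all coordinates. *)
Lemma lift_pointE t : t = lift_point (lsubmx t) + (\sum_i t 0 i) *: e.
Proof.
rewrite big_split_ord/= big_ord1 -[in LHS](hsubmxK t); apply/rowP => j.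
rewrite !mxE; case: split_ordP => i ->; rewrite ?eq_lrshift ?andbF ?mulr0 ?addr0 ?mxE//.
rewrite (ord1 i) !eqxx mulr1.
under [X in - X]eq_bigr do rewrite mxE.
by rewrite addKr.
Qed.

Lemma lift_point_sum x : \sum_i lift_point x 0 i = 0.
Proof.
rewrite big_split_ord/= big_ord1 row_mxEr mxE.
by under eq_bigr do rewrite row_mxEl; rewrite subrr.
Qed.

Definition lift_shift (c : R) x := lift_point x + c *: e.

Lemma lift_shift_affine c : affine_map (lift_shift c).
Proof.
move=> x y t; rewrite /lift_shift lift_pointD !lift_pointZ !scalerDr addrACA.
by congr (_ + _); rewrite -scalerDl addrC subrK scale1r.
Qed.

Lemma lsubmx_affine : affine_map (@lsubmx R 1 n 1).
Proof. by move=> x y t; rewrite linearD !linearZ. Qed.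

(** For t in T and t' in T' the sums of the coordinates of t and t' add up to 0,
    so each of them is constant. Hence T and T' are shifts of lifts by opposite
    multiples of the last basis vector, and the first n coordinates carry the
    relation T + T' = l (lift Z) over to their projections. *)
Lemma DC_lift Z : DC (lift_set Z) = lifted_cone (DC Z).
Proof.
apply/seteqP; split.
  move=> T [pT pZ [l [T' [l0 pT' TT']]]].
  have sum0 t t' : T t -> T' t' -> \sum_i t 0 i + \sum_i t' 0 i = 0.
    move=> Tt Tt'; have [_ [z _ <-] E] : dilate l (lift_set Z) (t + t').
      by rewrite -TT'; exists t => //; exists t'.
    transitivity (l * \sum_i lift_point z 0 i); last by rewrite lift_point_sum mulr0.
    rewrite -big_split/= mulr_sumr; apply: eq_bigr => i _.
    by have /rowP/(_ i) := E; rewrite !mxE.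
  have [t0' Tt0'] := polytope_nonempty pT'.
  have sumT t : T t -> \sum_i t 0 i = - \sum_i t0' 0 i.
    by move=> /sum0 /(_ Tt0') /eqP; rewrite addr_eq0 => /eqP.
  exists (lsubmx @` T), (- \sum_i t0' 0 i); split; last first.
    apply/seteqP; split.
      move=> t Tt; exists (lift_point (lsubmx t)).
        by exists (lsubmx t) => //; exists t.
      by rewrite -(sumT t)// -lift_pointE.
    by move=> _ [_ [_ [t Tt <-] <-] <-]; rewrite -(sumT t)// -lift_pointE.
  have pZ' : polytope Z.
    suff -> : Z = lsubmx @` lift_set Z.
      by apply: polytope_image => //; exact: lsubmx_affine.
    apply/seteqP; split; last by move=> _ [_ [z Zz <-] <-]; rewrite lift_pointK.
    by move=> z Zz; exists (lift_point z); [exists z|exact: lift_pointK].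
  split=> //; first by apply: polytope_image => //; exact: lsubmx_affine.
  exists l, (lsubmx @` T'); split=> //.
    by apply: polytope_image => //; exact: lsubmx_affine.
  apply/seteqP; split.
    move=> _ [_ [t Tt <-] [_ [t' Tt' <-] <-]].
    have [_ [z Zz <-] E] : dilate l (lift_set Z) (t + t').
      by rewrite -TT'; exists t => //; exists t'.
    by exists z => //; rewrite -linearD -E linearZ/= lift_pointK.
  move=> _ [z Zz <-].
  have [t Tt [t' Tt' E]] : msum T T' (l *: lift_point z).
    by rewrite TT'; exists (lift_point z) => //; exists z.
  exists (lsubmx t); first by exists t.
  exists (lsubmx t'); first by exists t'.
  by rewrite -linearD E linearZ/= lift_pointK.
move=> _ [S [c [[pS pZ [l [S' [l0 pS' SS']]]] ->]]].
have imgE (A : set 'rV[R]_n) a : [set x + a *: e | x in lift_set A] = lift_shift a @` A.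
  by rewrite /lift_set image_comp.
have lift_setE A : lift_set A = lift_shift 0 @` A.
  by rewrite -imgE; under eq_imagel do rewrite scale0r addr0; rewrite image_id.
split; rewrite ?imgE.
- by apply: polytope_image => //; exact: lift_shift_affine.
- by rewrite lift_setE; apply: polytope_image => //; exact: lift_shift_affine.
exists l, (lift_shift (- c) @` S'); split=> //.
  by apply: polytope_image => //; exact: lift_shift_affine.
have addE x y : lift_shift c x + lift_shift (- c) y = lift_point (x + y).
  by rewrite /lift_shift addrACA -scalerDl subrr scale0r addr0 lift_pointD.
apply/seteqP; split.
  move=> _ [_ [x Sx <-] [_ [y Sy <-] <-]]; rewrite addE.
  have [z Zz <-] : dilate l Z (x + y) by rewrite -SS'; exists x => //; exists y.
  by exists (lift_point z); [exists z|rewrite lift_pointZ].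
move=> _ [_ [z Zz <-] <-].
have [x Sx [y Sy E]] : msum S S' (l *: z) by rewrite SS'; exists z.
exists (lift_shift c x); first by exists x.
by exists (lift_shift (- c) y); [exists y|rewrite addE E lift_pointZ].
Qed.

End Lift.

(** * The deformation cone of a GP-sum *)

Theorem theorem2p23 (R : realType) (n : nat) (P Q : set 'rV[R]_n)
    (hP : SC R n P) (hQ : SC R n Q) (hQP : generic_quotient Q P) :
  DC (gpsum Q P) = admissibility_cone P Q /\
  DC (lift_set (gpsum Q P)) = lifted_cone (admissibility_cone P Q).
Proof.
have gP := SC_gen_perm hP; have gQ := SC_gen_perm hQ.
have QP : quotient Q P by move=> s i; apply/ltW/hQP.
have DCE : DC (gpsum Q P) = admissibility_cone P Q.
  apply/seteqP; split; first exact: deformation_admissible.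
  exact: admissible_deformation.
by rewrite DC_lift DCE.
Qed.
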